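(* Let $H\in\mathcal N_2$ be a normal affine semigroup in $\mathbb N^2$ with extremal rays $\mathbf a_1=(x_1,y_1)$ and $\mathbf a_2=(x_2,y_2)$, labeled so that $\mathbf a_1$ is closer to the $x$-axis. Assume that $(1,1)$ belongs to $\omega_H$ (so $(1,1)$ is the bottom element of $H$) and that $H_1^*\ne\emptyset$. Let $n=x_1-y_1-1$ (which equals $|H_1^*|$). Define recursively non-negative integers $\ell_1,\dots,\ell_n$ and $s_1,\dots,s_n$ by $$x_1=\ell_1(x_1-y_1)+s_1\quad\text{with } s_1<x_1-y_1,$$ and $$y_1+s_{i-1}=\ell_i(x_1-y_1)+s_i\quad\text{with } s_i<x_1-y_1,\qquad i=2,\dots,n.$$ Then $$H_1^*=\Big\{\mathbf p_t=(c_t,d_t): c_t=t+\sum_{i=1}^t\ell_i,\ d_t=\sum_{i=1}^t\ell_i,\ t=1,\dots,n\Big\}.$$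
   Context: $\mathbb N=\{0,1,2,\dots\}$. $\mathcal N_2$ is the class of normal affine semigroups $H\subseteq\mathbb N^2$ generating $\mathbb Z^2$ as a group: $H$ is a finitely generated submonoid of $\mathbb N^2$ with $H=C\cap\mathbb Z^2$, where $C\subseteq\mathbb R^2$ is the (two-dimensional) cone generated by $H$. The extremal rays of $H$ are the primitive lattice vectors $\mathbf a_1,\mathbf a_2\in H$ lying on the two extremal rays of $C$. They are labeled $\mathbf a_1=(x_1,y_1)$, $\mathbf a_2=(x_2,y_2)$ so that $x_1>0$ and either $x_2=0$ or $y_1/x_1<y_2/x_2$. Put $\omega_H=\mathbb Z^2\cap\operatorname{relint}C$. The bottom element of $H$ is the least element of $\omega_H$ for the componentwise order; here it is $\mathbf b=(1,1)$. $H_1^*=\mathbb Z^2\cap\{r\mathbf a_1+s\mathbf b:0<r,s<1\}$ with $\mathbf b=(1,1)$. *)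

(* Defs.v *)
From HB Require Import structures.
From mathcomp Require Import all_boot all_order all_algebra.
From mathcomp Require Import all_classical all_reals all_analysis.

Set Implicit Arguments.
Unset Strict Implicit.
Unset Printing Implicit Defensive.

Import Order.TTheory GRing.Theory Num.Theory.
Import numFieldNormedType.Exports.

Local Open Scope classical_set_scope.
Local Open Scope ring_scope.

Section Cones.
Variables (R : realType) (V : normedModType R).

Definition cone (A : set V) : set V :=
  [set x | exists m (v : 'I_m -> V) (c : 'I_m -> R),
     [/\ forall i, A (v i), forall i, 0 <= c i & x = \sum_(i < m) c i *: v i]].

Definition affine_hull (A : set V) : set V :=
  [set x | exists m (v : 'I_m -> V) (c : 'I_m -> R),
     [/\ forall i, A (v i), \sum_(i < m) c i = 1
       & x = \sum_(i < m) c i *: v i]].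

Definition relint (A : set V) : set V :=
  [set x | A x /\ within (affine_hull A) (nbhs x) A].

Definition extremal_ray (C L : set V) : Prop :=
  (exists2 v : V, v != 0 & L = [set r *: v | r in [set r : R | 0 <= r]]) /\
  L `<=` C /\
  (forall u w, C u -> C w -> L (u + w) -> L u /\ L w).

End Cones.

Definition toR2 (R : realType) (z : int * int) : R * R :=
  (z.1%:~R, z.2%:~R).

Definition semigroup_cone (R : realType) (H : set (int * int)) : set (R * R) :=
  cone (@toR2 R @` H).

Definition fin_gen_submonoid (H : set (int * int)) : Prop :=
  exists m (g : 'I_m -> int * int),
    H = [set z | exists k : 'I_m -> nat, z = \sum_(i < m) g i *+ k i].

Definition generates_Z2 (H : set (int * int)) : Prop :=
  forall z : int * int, exists m (h : 'I_m -> int * int) (k : 'I_m -> int),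
    (forall i, H (h i)) /\ z = \sum_(i < m) h i *~ k i.

Definition class_N2 (R : realType) (H : set (int * int)) : Prop :=
  [/\ forall z, H z -> 0 <= z.1 /\ 0 <= z.2,
      fin_gen_submonoid H,
      generates_Z2 H
    & H = [set z | semigroup_cone H (toR2 R z)]].

Definition primitive_vector (z : int * int) : Prop := coprimez z.1 z.2.

Definition extremal_vector (R : realType) (H : set (int * int))
    (a : int * int) : Prop :=
  [/\ H a, primitive_vector a
    & exists2 L : set (R * R), extremal_ray (semigroup_cone H) L & L (toR2 R a)].

Definition omega (R : realType) (H : set (int * int)) : set (int * int) :=
  [set z | relint (semigroup_cone H) (toR2 R z)].

Definition bottom_element (R : realType) (H : set (int * int))
    (b : int * int) : Prop :=
  omega R H b /\ forall z, omega R H z -> b.1 <= z.1 /\ b.2 <= z.2.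

(* For [a = a_1] and [b = (1, 1)] this is the set H_1^*. *)
Definition open_parallelogram_points (R : realType) (a b : int * int) :
    set (int * int) :=
  [set z | exists r s : R,
     [/\ 0 < r < 1, 0 < s < 1
       & toR2 R z = r *: toR2 R a + s *: toR2 R b]].

(* The sequences are indexed from 1; the values [l 0] and [s 0] are unused. *)
Definition division_sequences (x1 y1 : int) (n : nat) (l s : nat -> nat) :
    Prop :=
  [/\ x1 = (l 1%N)%:Z * (x1 - y1) + (s 1%N)%:Z,
      (s 1%N)%:Z < x1 - y1
    & forall i : nat, (2 <= i <= n)%N ->
        y1 + (s i.-1)%:Z = (l i)%:Z * (x1 - y1) + (s i)%:Z /\
        (s i)%:Z < x1 - y1].

(* Main.v *)
(* Put m = x1 - y1. A lattice point r a1 + s (1, 1) with 0 < r, s < 1 has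
   coordinate difference t = r m in {1, ..., m - 1} and second coordinate d with
   0 < d m - t y1 < m, so that d = ceil (t y1 / m), as m is coprime to y1.
   Summing the division identities gives
   (l_1 + ... + l_t) m + s_t = t y1 + m with 0 < s_t < m, which singles out the
   same d. That m > 0 comes from (1, 1) being interior while a1 is extremal. *)
Require Import Defs.
From HB Require Import structures.
From mathcomp Require Import all_boot all_order all_algebra.
From mathcomp Require Import ring lra zify.
From mathcomp Require Import all_classical all_reals all_analysis.

Set Implicit Arguments.
Unset Strict Implicit.
Unset Printing Implicit Defensive.

Import Order.TTheory GRing.Theory Num.Theory.
Import numFieldNormedType.Exports.

Local Open Scope classical_set_scope.
Local Open Scope ring_scope.

Section ConeLemmas.
Variables (R : realType) (V : normedModType R).
Implicit Types (A : set V) (u v z : V).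

Lemma cone_sub A v : A v -> cone A v.
Proof.
move=> Av; exists 1%N, (fun=> v), (fun=> 1); split=> //.
by rewrite big_ord1 scale1r.
Qed.

Lemma coneZ A (k : R) v : 0 <= k -> cone A v -> cone A (k *: v).
Proof.
move=> k0 [m [w [c [Aw c0 ->]]]]; exists m, w, (fun i => k * c i); split=> //.
  by move=> i; rewrite mulr_ge0.
by rewrite scaler_sumr; apply: eq_bigr => i _; rewrite scalerA.
Qed.

Lemma cone0 A : cone A 0.
Proof.
by exists 0%N, (fun=> 0), (fun=> 0); split=> [[]||] //; rewrite big_ord0.
Qed.

(** As [e] tends to 0 from the right, [z - e *: v] tends to [z] inside the affine hull, so it enters
    the cone by relative openness. *)
Lemma relint_cone_sub A z v : relint (cone A) z -> cone A v ->
  exists2 e : R, 0 < e & cone A (z - e *: v).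
Proof.
move=> [Cz zC] Cv.
have lim : z - e *: v @[e --> (0 : R)^'+] --> z.
  rewrite -[X in _ --> X]subr0 -(scale0r v); apply: cvgB; first exact: cvg_cst.
  apply: cvgZr_tmp; apply: cvg_at_right_filter; exact: cvg_id.
have [e [e0]] : exists e : R, 0 < e /\
    (affine_hull (cone A) (z - e *: v) -> cone A (z - e *: v)).
  apply: (@filter_ex _ (0 : R)^'+); apply: filterI; first exact: nbhs_right_gt.
  exact: (lim _ zC).
move=> Ce; exists e => //; apply: Ce.
(* The apex 0 lies in the cone and takes weight [e], so that the weights 1, [- e], [e] sum to 1. *)
exists 3%N, (fun i : 'I_3 => nth 0 [:: z; v; 0] i),
  (fun i : 'I_3 => nth 0 [:: 1; - e; e] i); split.
- by move=> [[|[|[|]]]] //= _; exact: cone0.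
- by rewrite !big_ord_recl big_ord0 /=; ring.
- by rewrite !big_ord_recl big_ord0 /= scale1r scaler0 !addr0 scaleNr.
Qed.

End ConeLemmas.

Section PlaneCones.
Variables (R : realType) (H : set (int * int)).
Local Notation C := (semigroup_cone H : set (R * R)).

Lemma toR2_semigroup_cone h : H h -> C (toR2 R h).
Proof. by move=> Hh; apply: cone_sub; exists h. Qed.

Lemma semigroup_cone_ge0 (x : R * R) :
  (forall h, H h -> 0 <= h.1 /\ 0 <= h.2) -> C x -> 0 <= x.1 /\ 0 <= x.2.
Proof.
move=> H0 [m [v [c [vH c0 ->]]]].
apply: (big_ind (fun x : R * R => 0 <= x.1 /\ 0 <= x.2)) => //=.
  by move=> x1 x2 [? ?] [? ?]; rewrite !addr_ge0.
move=> i _; have [h Hh <-] := vH i; have [h1 h2] := H0 _ Hh.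
by rewrite /= !mulr_ge0 ?ler0z.
Qed.

(** Subtracting a small positive multiple of [(1, 1)] from [z] stays in the cone, hence in the
    closed quadrant; so both integer coordinates are positive. *)
Lemma omega_ge1 z : (forall h, H h -> 0 <= h.1 /\ 0 <= h.2) ->
  omega R H (1, 1) -> omega R H z -> 1 <= z.1 /\ 1 <= z.2.
Proof.
move=> H0 [C11 _] /relint_cone_sub/(_ C11)[e e0].
move=> /(semigroup_cone_ge0 H0)[]; rewrite /= !scaler1 !subr_ge0 => z1 z2.
by rewrite -!gtz0_ge1 -!(ltr0z R) !(lt_le_trans e0).
Qed.

Lemma extremal_vector_below_diagonal (x1 y1 x2 y2 : int) :
  (forall h, H h -> 0 <= h.1 /\ 0 <= h.2) ->
  extremal_vector R H (x1, y1) -> H (x2, y2) ->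
  0 < x1 * y2 - x2 * y1 -> omega R H (1, 1) -> y1 < x1.
Proof.
move=> H0 [H1 _ [L [[v _ LE] [LC Lface]] L1]] H2 D0 o11.
rewrite ltNge; apply/negP => le_xy.
have [/= x10 y10] := H0 _ H1; have [/= x20 y20] := H0 _ H2.
have C2 := toR2_semigroup_cone H2.
have xy2 : x2 < y2 by nia.
have [e e0 Ce] := relint_cone_sub o11 C2.
set D := x1 * y2 - x2 * y1 in D0.
(* Cramer's rule gives D (1, 1) = (y2 - x2) a1 + (x1 - y1) a2; moving D e a2 across leaves the
   coefficient [k] on a2. *)
pose k : R := (y1 - x1)%:~R + D%:~R * e.
have DR0 : 0 < D%:~R :> R by rewrite ltr0z.
have k0 : 0 < k by rewrite ltr_wpDl ?mulr_gt0 // ler0z subr_ge0.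
(* If y1 >= x1, then a1 is a positive combination of (1, 1) - e a2 and a2, so
   extremality of its ray forces a2 onto that ray, against D > 0. *)
have decomp : D%:~R *: (toR2 R (1, 1) - e *: toR2 R (x2, y2)) +
    k *: toR2 R (x2, y2) = (y2 - x2)%:~R *: toR2 R (x1, y1).
  rewrite /k /D /toR2; apply: injective_projections => /=;
    rewrite /GRing.scale /= !(rmorphB, rmorphM) /=; ring.
have [r /= r0 rv] : [set r *: v | r in [set r : R | 0 <= r]] (toR2 R (x1, y1)).
  by rewrite -LE.
have Lsum : L (D%:~R *: (toR2 R (1, 1) - e *: toR2 R (x2, y2)) +
    k *: toR2 R (x2, y2)).
  rewrite decomp LE; exists ((y2 - x2)%:~R * r).
    by rewrite /= mulr_ge0 // ler0z subr_ge0 ltW.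
  by rewrite -scalerA rv.
have [_] := Lface _ _ (coneZ (ltW DR0) Ce) (coneZ (ltW k0) C2) Lsum.
rewrite LE => -[q _]; move: rv; rewrite /toR2 => -[rx ry] [qx qy].
(* This is the determinant of a1 and k a2, which are now both multiples of [v]. *)
have : k * D%:~R = 0.
  rewrite /D rmorphB !rmorphM /= mulrBr mulrCA (mulrA k) -[k * y2%:~R]qy.
  by rewrite -[k * x2%:~R]qx -rx -ry /GRing.scale /=; ring.
by apply/eqP; rewrite mulf_neq0 ?gt_eqF // ltr0z.
Qed.

End PlaneCones.

(** With n + 1 = x1 - y1, the dictionary is t = r (n + 1) and d (n + 1) - t y = s (n + 1); the
    bounds on r and s become integer inequalities. *)
Lemma open_parallelogram_pointsE (R : realType) (y n : nat) :
  open_parallelogram_points R ((y + n.+1)%N%:Z, y%:Z) (1, 1) =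
  [set z | exists t d : nat, [/\ (1 <= t <= n)%N,
     (t * y < d * n.+1 < t * y + n.+1)%N & z = ((t + d)%N%:Z, d%:Z)]].
Proof.
have n0 : 0 < n.+1%:R :> R by rewrite ltr0n.
apply/seteqP; split=> [[c d] /= [r [s [/andP[r0 r1] /andP[s0 s1]]]]|].
  rewrite /toR2 /= => -[]; rewrite /GRing.scale /= => cE dE.
  have d0 : 0 < d.
    rewrite -(ltr0z R) dE mulr1; apply: ltr_wpDl => //.
    by rewrite mulr_ge0 ?ler0z // ltW.
  have tE : (c - d)%:~R = r * n.+1%:R.
    by rewrite rmorphB /= cE dE -!pmulrn natrD; ring.
  have t0 : 0 < c - d by rewrite -(ltr0z R) tE mulr_gt0.
  have tn : c - d < n.+1.
    by rewrite -(ltr_int R) tE -pmulrn -[ltRHS]mul1r ltr_pM2r.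
  have gapE : (d * n.+1%:Z - (c - d) * y%:Z)%:~R = s * n.+1%:R :> R.
    rewrite rmorphB !rmorphM /= tE dE -!pmulrn; ring.
  have g0 : 0 < d * n.+1%:Z - (c - d) * y%:Z.
    by rewrite -(ltr0z R) gapE mulr_gt0.
  have gn : d * n.+1%:Z - (c - d) * y%:Z < n.+1.
    by rewrite -(ltr_int R) gapE -pmulrn -[ltRHS]mul1r ltr_pM2r.
  exists `|c - d|%N, `|d|%N; split; [lia | nia |].
  by congr pair; lia.
move=> _ [t [d [/andP[t1 tn] /andP[d1 d2] ->]]] /=.
have h1 : t%:R * y%:R < d%:R * n.+1%:R :> R by rewrite -!natrM ltr_nat.
have h2 : d%:R * n.+1%:R < t%:R * y%:R + n.+1%:R :> R.
  by rewrite -!natrM -natrD ltr_nat.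
exists (t%:R / n.+1%:R), ((d%:R * n.+1%:R - t%:R * y%:R) / n.+1%:R); split.
- by rewrite divr_gt0 ?ltr0n //= ltr_pdivrMr // mul1r ltr_nat.
- rewrite divr_gt0 ?subr_gt0 //= ltr_pdivrMr // mul1r; lra.
- rewrite /toR2; apply: injective_projections;
    rewrite /= /GRing.scale /= -!pmulrn ?natrD; field; lra.
Qed.

Section DivisionSequences.
Variables (y n : nat).

Lemma division_sequences_exist :
  exists l s, division_sequences (y + n.+1)%N%:Z y%:Z n l s.
Proof.
(* Starting from s_0 = x_1 - y_1, the first division has the general form. *)
pose s i := iter i (fun r => (y + r) %% n.+1)%N n.+1.
exists (fun i => (y + s i.-1) %/ n.+1)%N, s.
have mE : (y + n.+1)%N%:Z - y%:Z = n.+1%:Z by lia.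
rewrite /division_sequences mE; split.
- by rewrite -PoszM -PoszD -divn_eq.
- by rewrite ltz_nat ltn_mod.
- move=> [|i] // _; rewrite -PoszM -!PoszD [s i.+1]iterS -divn_eq.
  by split=> //; rewrite ltz_nat ltn_mod.
Qed.

(** The identities telescope, each remainder entering the next dividend; the extra [n.+1] comes from
    the first dividend, [y + n.+1]. *)
Lemma division_sequences_sum (l s : nat -> nat) (t : nat) :
  division_sequences (y + n.+1)%N%:Z y%:Z n l s -> (1 <= t <= n)%N ->
  ((\sum_(1 <= i < t.+1) l i) * n.+1 + s t = t * y + n.+1 /\ s t < n.+1)%N.
Proof.
have mE : (y + n.+1)%N%:Z - y%:Z = n.+1%:Z by lia.
rewrite /division_sequences mE => -[l1 s1 ls].
elim: t => // -[_ _|t IH tn]; first by rewrite big_nat1; split; lia.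
have [IHs _] : (_ /\ (s t.+1 < n.+1)%N) := IH (ltnW tn).
have [/= lt st] := ls t.+2 tn.
by rewrite big_nat_recr //=; split; nia.
Qed.

Lemma ceil_division_sequences_sum (l s : nat -> nat) (t d : nat) :
  coprime y n.+1 -> division_sequences (y + n.+1)%N%:Z y%:Z n l s ->
  (1 <= t <= n)%N ->
  (t * y < d * n.+1 < t * y + n.+1)%N = (d == \sum_(1 <= i < t.+1) l i)%N.
Proof.
move=> cop dls tn; have [] := division_sequences_sum dls tn.
set S := (\sum_(_ <= _ < _) _)%N => SE sn.
(* A zero remainder would make [n.+1] divide [t * y], hence [t] by coprimality, although 1 <= t <=
   n. *)
have s0 : (0 < s t)%N.
  rewrite lt0n; apply/eqP => s0; have : (n.+1 %| t * y)%N.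
    by rewrite -(dvdn_addl _ (dvdnn n.+1)) -SE s0 addn0 dvdn_mull.
  rewrite Gauss_dvdl 1?coprime_sym // => /dvdn_leq; lia.
(* An open interval of length [n.+1] with integer ends contains at most one multiple of [n.+1], and
   [S * n.+1] lies in this one. *)
by apply/idP/eqP => [/andP[]|->]; nia.
Qed.

End DivisionSequences.

Theorem lemma6p1 (R : realType) (H : set (int * int)) (x1 y1 x2 y2 : int)
  (HN2 : class_N2 R H)
  (Ha1 : extremal_vector R H (x1, y1))
  (Ha2 : extremal_vector R H (x2, y2))
  (Hx1 : 0 < x1)
  (Hlabel : x2 = 0 \/ y1%:Q / x1%:Q < y2%:Q / x2%:Q)
  (Hb : omega R H (1, 1))
  (Hne : open_parallelogram_points R (x1, y1) (1, 1) !=set0) :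
  bottom_element R H (1, 1) /\
  exists n : nat,
    [/\ n%:Z = x1 - y1 - 1,
        (open_parallelogram_points R (x1, y1) (1, 1) #= `I_n)%card,
        exists l s : nat -> nat, division_sequences x1 y1 n l s
      & forall l s : nat -> nat, division_sequences x1 y1 n l s ->
          open_parallelogram_points R (x1, y1) (1, 1) =
          [set p | exists t : nat, (1 <= t <= n)%N /\
             p = ((t + \sum_(1 <= i < t.+1) l i)%N%:Z,
                  (\sum_(1 <= i < t.+1) l i)%N%:Z)]].
Proof.
have [H0 _ _ _] := HN2; have [H1 cop _] := Ha1; have [H2 cop2 _] := Ha2.
have [/= _ y10] := H0 _ H1; have [/= x20 y20] := H0 _ H2.
(* The labeling of the rays amounts to a positive determinant. If [x2 = 0], primitivity rules out a2
   = (0, 0). *)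
have D0 : 0 < x1 * y2 - x2 * y1.
  have [x2E|slope] := Hlabel.
    have : y2 <> 0 by move=> y2E; move: cop2; rewrite /primitive_vector x2E y2E.
    by rewrite x2E mul0r subr0 => ?; apply: mulr_gt0 => //; lia.
  (* Division by zero yields 0 here, so [x2 = 0] would give a negative slope y1 / x1. *)
  have x2n0 : x2 <> 0.
    move=> x2E; move: slope; rewrite x2E invr0 mulr0 ltNge => /negP; apply.
    by rewrite divr_ge0 // ler0z // ltW.
  have x2gt0 : 0 < x2 by lia.
  move: slope; rewrite ltr_pdivlMr ?ltr0z // mulrAC ltr_pdivrMr ?ltr0z //.
  by rewrite -!rmorphM /= ltr_int; lia.
have xy1 := extremal_vector_below_diagonal H0 Ha1 H2 D0 Hb.
split; first by split=> // z; exact: omega_ge1.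
pose y := `|y1|%N; pose n := `|(x1 - y1 - 1)%R|%N.
have y1E : y1 = y%:Z by lia.
have x1E : x1 = (y + n.+1)%N%:Z by lia.
have {}cop : coprime y n.+1.
  move: cop; rewrite /primitive_vector /= x1E y1E /coprimez /gcdz /=.
  by rewrite eqz_nat gcdnC gcdnDl.
clearbody y n; subst x1 y1.
have pointsE l s : division_sequences (y + n.+1)%N%:Z y%:Z n l s ->
    open_parallelogram_points R ((y + n.+1)%N%:Z, y%:Z) (1, 1) =
    [set p | exists t : nat, (1 <= t <= n)%N /\
       p = ((t + \sum_(1 <= i < t.+1) l i)%N%:Z,
            (\sum_(1 <= i < t.+1) l i)%N%:Z)].
  move=> dls; rewrite open_parallelogram_pointsE //.
  apply/seteqP; split=> [p [t [d [tn]]]|p [t [tn ->]]].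
    rewrite (ceil_division_sequences_sum _ cop dls tn) => /eqP -> ->.
    by exists t.
  exists t, (\sum_(1 <= i < t.+1) l i)%N.
  by rewrite (ceil_division_sequences_sum _ cop dls tn).
exists n; split; [lia | | exact: division_sequences_exist | exact: pointsE].
have [l [s /pointsE ->]] := division_sequences_exist y n.
pose f k := ((k.+1 + \sum_(1 <= i < k.+2) l i)%N%:Z,
             (\sum_(1 <= i < k.+2) l i)%N%:Z).
have -> : [set p | exists t : nat, (1 <= t <= n)%N /\
       p = ((t + \sum_(1 <= i < t.+1) l i)%N%:Z,
            (\sum_(1 <= i < t.+1) l i)%N%:Z)] = f @` `I_n.
  apply/seteqP; split=> p; last by move=> [k kn <-]; exists k.+1.
  by move=> [[|k] [kn ->]] //; exists k.
(* The difference of the two coordinates of [f k] is [k.+1], which makes [f] injective. *)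
apply: inj_card_eq => j k _ _; rewrite /f => -[+ jk].
by rewrite jk => /addIn[].
Qed.
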